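(* There is a $\langle 2,2,2\rangle$-sized tensor $T$ with $$\frac{\log\operatorname{rank}(T)}{\log\operatorname{eff}(T)}<1.797.$$ Namely, $T=T_{2112}$ with $\varepsilon=0.025$ (defined in the context) satisfies $\operatorname{rank}(T)\le 5$ and this inequality. Such a tensor ''achieves the exponent'' $1.797$ for the light bulb problem.
   Context: A $\langle q,q,q_k\rangle$-sized tensor is a trilinear form $T=\sum T(\mathsf X_{i,k}\mathsf Y_{j,k'}\mathsf Z_{i',j'})\,\mathsf X_{i,k}\mathsf Y_{j,k'}\mathsf Z_{i',j'}$ over variables $\mathsf X_{i,k},\mathsf Y_{j,k},\mathsf Z_{i,j}$, with real coefficients. - $\operatorname{rank}(T)$ is the minimum number of rank-1 tensors $(\sum a_{i,k}\mathsf X_{i,k})(\sum b_{j,k}\mathsf Y_{j,k})(\sum c_{i,j}\mathsf Z_{i,j})$ summing to $T$. - $\operatorname{eff}_{i,j}(T)=\dfrac{\sum_k T(\mathsf X_{i,k}\mathsf Y_{j,k}\mathsf Z_{i,j})}{\sqrt{\sum_{i',j',k,k'}T(\mathsf X_{i',k}\mathsf Y_{j',k'}\mathsf Z_{i,j})^2}}$ and $\operatorname{eff}(T)=\sqrt{\sum_{i,j}\operatorname{eff}_{i,j}(T)^2}$. With index set $\{0,1\}$ and a parameter $\varepsilon>0$, define $$\begin{aligned} T_{2112}={}&(\mathsf X_{00}\mathsf Y_{00}+\mathsf X_{01}\mathsf Y_{01}+\varepsilon^3\mathsf X_{11}\mathsf Y_{10}+\varepsilon\mathsf X_{10}\mathsf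 Y_{11})\mathsf Z_{00}\\ &+(\varepsilon^4\mathsf X_{00}\mathsf Y_{10}+\mathsf X_{01}\mathsf Y_{11}+\varepsilon\mathsf X_{11}\mathsf Y_{00}+\varepsilon^3\mathsf X_{10}\mathsf Y_{01})\mathsf Z_{01}\\ &+(\mathsf X_{10}\mathsf Y_{00}+\varepsilon^4\mathsf X_{11}\mathsf Y_{01}+\varepsilon\mathsf X_{01}\mathsf Y_{10}+\varepsilon^3\mathsf X_{00}\mathsf Y_{11})\mathsf Z_{10}\\ &+(\mathsf X_{10}\mathsf Y_{10}+\mathsf X_{11}\mathsf Y_{11}+\varepsilon\mathsf X_{00}\mathsf Y_{01})\mathsf Z_{11}. \end{aligned}$$ Here $\mathsf X_{ab}$ means $\mathsf X_{a,b}$, and similarly for $\mathsf Y$ and $\mathsf Z$. *)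

(* Defs.v *)
From HB Require Import structures.
From mathcomp Require Import all_boot all_order all_algebra.
From mathcomp Require Import boolp reals.
Set Implicit Arguments.
Unset Strict Implicit.
Unset Printing Implicit Defensive.
Import Order.TTheory GRing.Theory Num.Theory.
Local Open Scope ring_scope.

(* In a <q, q, r>-sized tensor, (i, k), (j, k') and (i', j') name the variables
   X_{i,k}, Y_{j,k'} and Z_{i',j'}. *)
Notation xvar q r := ('I_q * 'I_r)%type.
Notation yvar q r := ('I_q * 'I_r)%type.
Notation zvar q := ('I_q * 'I_q)%type.

(* A trilinear form, given by its coefficients: T (x, y, z) is T(XYZ). *)
Notation tensor R q r := {ffun xvar q r * yvar q r * zvar q -> R}.

Section Tensors.
Context {R : realType} {q r : nat}.

Definition prod_tensor (a : xvar q r -> R) (b : yvar q r -> R)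
    (c : zvar q -> R) : tensor R q r :=
  [ffun m => a m.1.1 * b m.1.2 * c m.2].

Definition rank1_tensor (S : tensor R q r) : Prop :=
  exists a b c, S = prod_tensor a b c.

Definition sum_of_rank1 (T : tensor R q r) (n : nat) : Prop :=
  exists F : 'I_n -> tensor R q r,
    (forall s, rank1_tensor (F s)) /\ T = \sum_(s < n) F s.

(* The form w X_x Y_y Z_z. *)
Definition monom (w : R) (x : xvar q r) (y : yvar q r) (z : zvar q) :
    tensor R q r :=
  [ffun m => if m == (x, y, z) then w else 0].

Lemma monom_rank1 w x y z : rank1_tensor (monom w x y z).
Proof.
exists (fun x' => if x' == x then w else 0), (fun y' => (y' == y)%:R),
  (fun z' => (z' == z)%:R).
apply/ffunP => -[[x' y'] z']; rewrite !ffunE /= !xpair_eqE.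
by case: (x' == x); case: (y' == y); case: (z' == z);
  rewrite /= ?mulr1 ?mulr0 ?mul0r.
Qed.

Lemma tensor_sum_monom (T : tensor R q r) :
  T = \sum_m monom (T m) m.1.1 m.1.2 m.2.
Proof.
apply/ffunP => m; rewrite sum_ffunE (bigD1 m) //= ffunE.
rewrite -!surjective_pairing eqxx big1 ?addr0 // => m' /negPf nm.
by rewrite ffunE -!surjective_pairing eq_sym nm.
Qed.

Lemma sum_of_rank1_ex (T : tensor R q r) : exists n, `[< sum_of_rank1 T n >].
Proof.
exists #|{: xvar q r * yvar q r * zvar q}|; apply/asboolP.
exists (fun s => let m := enum_val s in monom (T m) m.1.1 m.1.2 m.2).
split=> [s|]; first exact: monom_rank1.
by rewrite {1}(tensor_sum_monom T) big_enum_val.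
Qed.

Definition rank (T : tensor R q r) : nat := ex_minn (sum_of_rank1_ex T).

Definition eff_at (i j : 'I_q) (T : tensor R q r) : R :=
  (\sum_(k < r) T ((i, k), (j, k), (i, j))) /
  Num.sqrt (\sum_(i' < q) \sum_(j' < q) \sum_(k < r) \sum_(k' < r)
              T ((i', k), (j', k'), (i, j)) ^+ 2).

Definition eff (T : tensor R q r) : R :=
  Num.sqrt (\sum_(i < q) \sum_(j < q) eff_at i j T ^+ 2).

End Tensors.

Definition T2112 {R : realType} (e : R) : tensor R 2 2 :=
  (monom 1 (0, 0) (0, 0) (0, 0) + monom 1 (0, 1) (0, 1) (0, 0)
   + monom (e ^+ 3) (1, 1) (1, 0) (0, 0) + monom e (1, 0) (1, 1) (0, 0))
  + (monom (e ^+ 4) (0, 0) (1, 0) (0, 1) + monom 1 (0, 1) (1, 1) (0, 1)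
     + monom e (1, 1) (0, 0) (0, 1) + monom (e ^+ 3) (1, 0) (0, 1) (0, 1))
  + (monom 1 (1, 0) (0, 0) (1, 0) + monom (e ^+ 4) (1, 1) (0, 1) (1, 0)
     + monom e (0, 1) (1, 0) (1, 0) + monom (e ^+ 3) (0, 0) (1, 1) (1, 0))
  + (monom 1 (1, 0) (1, 0) (1, 1) + monom 1 (1, 1) (1, 1) (1, 1)
     + monom e (0, 0) (0, 1) (1, 1)).

(* Main.v *)
Require Import Defs.
From mathcomp Require Import all_boot all_order all_algebra.
From mathcomp Require Import boolp reals exp.
From mathcomp Require Import ring lra.
Import Order.TTheory GRing.Theory Num.Theory.
Local Open Scope ring_scope.

(** Adding the missing monomial [e^-5 X_01 Y_00 Z_11] to [T2112 e] yields, after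
    relabelling and rescaling the variables, the structure tensor of the group
    algebra of [Z/2 x Z/2], which its four characters diagonalise; hence the
    rank is at most [4 + 1].  The squared efficiency is at least [6 - 4 e^2],
    that is [5.9975 = 2399 / 400] at [e = 0.025], and [5 ^ 197 < 5.9975 ^ 177]
    with [177 / 197 < 1.797 / 2]. *)

Section Rank.
Context {R : realType}.

Lemma rank_le {q r : nat} (T : tensor R q r) (n : nat) :
  sum_of_rank1 T n -> (rank T <= n)%N.
Proof. by move=> Tn; rewrite /rank; case: ex_minnP => m _; apply; apply/asboolP. Qed.

(** Equations as premises let repeated [apply:] descend a sum of tensors and evaluate each
    summand. *)
Lemma tensorD_eq {q r : nat} (S T : tensor R q r) m (a b : R) :
  S m = a -> T m = b -> (S + T) m = a + b.
Proof. by move=> <- <-; rewrite ffunE. Qed.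

Lemma monomE {q r : nat} (w : R) (x : xvar q r) (y : yvar q r) (z : zvar q) m :
  monom w x y z m = if m == (x, y, z) then w else 0.
Proof. by rewrite ffunE. Qed.

Lemma prod_tensorE {q r : nat} (a : xvar q r -> R) (b : yvar q r -> R)
    (c : zvar q -> R) m :
  prod_tensor a b c m = a m.1.1 * b m.1.2 * c m.2.
Proof. by rewrite ffunE. Qed.

Lemma T2112E (e : R) m :
  let c (w : R) (x y z : 'I_2 * 'I_2) := if m == (x, y, z) then w else 0 in
  T2112 e m =
  (c 1 (0, 0) (0, 0) (0, 0) + c 1 (0, 1) (0, 1) (0, 0)
   + c (e ^+ 3) (1, 1) (1, 0) (0, 0) + c e (1, 0) (1, 1) (0, 0))
  + (c (e ^+ 4) (0, 0) (1, 0) (0, 1) + c 1 (0, 1) (1, 1) (0, 1)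
     + c e (1, 1) (0, 0) (0, 1) + c (e ^+ 3) (1, 0) (0, 1) (0, 1))
  + (c 1 (1, 0) (0, 0) (1, 0) + c (e ^+ 4) (1, 1) (0, 1) (1, 0)
     + c e (0, 1) (1, 0) (1, 0) + c (e ^+ 3) (0, 0) (1, 1) (1, 0))
  + (c 1 (1, 0) (1, 0) (1, 1) + c 1 (1, 1) (1, 1) (1, 1)
     + c e (0, 0) (0, 1) (1, 1)).
Proof. by do !apply: tensorD_eq; exact: monomE. Qed.

Definition table (a b c d : R) (m : 'I_2 * 'I_2) : R :=
  if m.1 == 0 then if m.2 == 0 then a else b else if m.2 == 0 then c else d.

(* The summand of the character of Z/2 x Z/2 with values s and t on the two
   generators; the powers of e rescale the variables. *)
Definition character_tensor (e s t : R) : tensor R 2 2 :=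
  prod_tensor
    (table (e ^+ 3 / (4 * e ^+ 5)) (t / (4 * e ^+ 5)) (s * e ^+ 2 / (4 * e ^+ 5))
       (s * t * e ^+ 3 / (4 * e ^+ 5)))
    (table 1 (t * e ^+ 3) (s * t * e ^+ 3) (s * e ^+ 2))
    (table (e ^+ 2) (s * t * e ^+ 3) (s * e ^+ 3) t).

Lemma ord2P (i : 'I_2) : i = 0 \/ i = 1.
Proof. by case: i => -[|[|//]] p; [left|right]; apply/val_inj. Qed.

(** By orthogonality of characters, summing over [s] and [t] in [{1, -1}] keeps the 16 monomials
    whose three characters multiply to 1, four times each; the denominators cancel the 4. The last
    summand removes the monomial absent from [T2112 e]. *)
Lemma T2112_decomposition (e : R) : e != 0 ->
  T2112 e = character_tensor e 1 1 + character_tensor e 1 (-1)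
    + character_tensor e (-1) 1 + character_tensor e (-1) (-1)
    + monom (- e ^- 5) (0, 1) (0, 0) (1, 1).
Proof.
move=> e0; apply/ffunP => -[[[i k] [j l]] [u v]].
apply: etrans (T2112E _ _) _; apply: esym.
apply: etrans.
  by do !apply: tensorD_eq; [exact: prod_tensorE .. | exact: monomE].
case: (ord2P i) => ->; case: (ord2P k) => ->; case: (ord2P j) => ->;
  case: (ord2P l) => ->; case: (ord2P u) => ->; case: (ord2P v) => ->;
  by rewrite /table /=; field.
Qed.

Lemma rank_T2112_le5 (e : R) : e != 0 -> (rank (T2112 e) <= 5)%N.
Proof.
move=> e0; apply: rank_le.
exists (fun s : 'I_5 => nth 0 [:: character_tensor e 1 1; character_tensor e 1 (-1);
  character_tensor e (-1) 1; character_tensor e (-1) (-1);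
  monom (- e ^- 5) (0, 1) (0, 0) (1, 1)] s).
split; last by rewrite !big_ord_recr big_ord0 /= add0r T2112_decomposition.
by case=> -[|[|[|[|[|//]]]]] p /=; do ?[exact: monom_rank1];
  do 3 eexists.
Qed.

End Rank.

Section Efficiency.
Context {R : realType}.

(** The terms come from [Z_00], from [Z_01] and [Z_10] together, and from [Z_11]. *)
Lemma eff_T2112_sqr (e : R) :
  eff (T2112 e) ^+ 2 = 4 / (2 + e ^+ 2 + e ^+ 6)
    + 2 * (1 + e ^+ 4) ^+ 2 / (1 + e ^+ 2 + e ^+ 6 + e ^+ 8)
    + 4 / (2 + e ^+ 2).
Proof.
have e2 : 0 <= e ^+ 2 by exact: sqr_ge0.
have e6 : 0 <= e ^+ 6 by rewrite (exprM e 2 3) exprn_ge0.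
have e8 : 0 <= e ^+ 8 by rewrite (exprM e 2 4) exprn_ge0.
rewrite /eff sqr_sqrtr; last by do 2 apply: sumr_ge0 => ? _; exact: sqr_ge0.
rewrite !big_ord_recl !big_ord0 /eff_at !expr_div_n !sqr_sqrtr;
  do ?[by do 4 apply: sumr_ge0 => ? _; exact: sqr_ge0].
rewrite !big_ord_recl !big_ord0 !T2112E /=.
by field; apply/and3P; split; apply/eqP; lra.
Qed.

(** With [x = e ^+ 2], each term lies above its tangent line at [x = 0]. *)
Lemma eff_T2112_sqr_ge (e : R) : 6 - 4 * e ^+ 2 <= eff (T2112 e) ^+ 2.
Proof.
rewrite eff_T2112_sqr (exprM e 2 2) (exprM e 2 3) (exprM e 2 4).
have : 0 <= e ^+ 2 by exact: sqr_ge0.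
move: (e ^+ 2) => x x0.
have x2 : 0 <= x ^+ 2 by exact: exprn_ge0.
have x3 : 0 <= x ^+ 3 by exact: exprn_ge0.
have x4 : 0 <= x ^+ 4 by exact: exprn_ge0.
have x5 : 0 <= x ^+ 5 by exact: exprn_ge0.
have A : 2 - x <= 4 / (2 + x + x ^+ 3).
  rewrite ler_pdivlMr; last by lra.
  (* The two sides differ by exactly this square. *)
  have := sqr_ge0 (x * (1 - x)); lra.
have B : 2 - 2 * x <= 2 * (1 + x ^+ 2) ^+ 2 / (1 + x + x ^+ 3 + x ^+ 4).
  rewrite ler_pdivlMr; last by lra.
  (* The square gives [2 x^3 <= x^2 + x^4], which absorbs the only negative term of the
     difference. *)
  have := sqr_ge0 (x * (1 - x)); lra.
have C : 2 - x <= 4 / (2 + x) by rewrite ler_pdivlMr; lra.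
lra.
Qed.

End Efficiency.

(** The fraction [177 / 197] lies between [ln 5 / ln 5.9975] and [0.8985], so exact rational
    arithmetic replaces numerical logarithms. *)
Lemma pow5_lt (R : realType) : (5 : R) ^+ 197 < (2399 / 400) ^+ 177.
Proof. lra. Qed.

Lemma ln5_lt (R : realType) (x : R) : 0 <= x -> 2399 / 400 <= x ^+ 2 ->
  ln 5 < 1797%:R / 1000%:R * ln x.
Proof.
move=> x0 x2.
have x1 : 1 < x by nra.
have lnx : 0 < ln x by rewrite ln_gt0.
have xpos : 0 < x by exact: le_lt_trans x1.
have p5 : 0 < 5 :> R by rewrite ltr0n.
have := pow5_lt R.
have : (2399 / 400) ^+ 177 <= (x ^+ 2) ^+ 177.
  by apply: lerXn2r x2; rewrite nnegrE; [lra | exact: sqr_ge0].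
move=> /[swap]/lt_le_trans/[apply].
rewrite -exprM -ltr_ln ?posrE; try exact: exprn_gt0.
rewrite lnXn // lnXn // -(mulr_natr (ln 5)) -(mulr_natr (ln x)).
(* Here [197 ln 5 < 354 ln x], and [354 / 197 < 1.797]. *)
lra.
Qed.

Theorem theorem1p2 (R : realType) :
  exists T : tensor R 2 2,
    [/\ T = T2112 (25%:R / 1000%:R),
        (rank T <= 5)%N
      & ln (rank T)%:R / ln (eff T) < 1797%:R / 1000%:R].
Proof.
set T := T2112 _.
have rankT : (rank T <= 5)%N by apply: rank_T2112_le5; apply/eqP; lra.
have ln_rankT : ln (rank T)%:R <= ln 5 :> R.
  (* Since [ln 0 = 0] by convention, no lower bound on the rank is required. *)
  have [->|r0] := posnP (rank T); first by rewrite ln0 // ln_ge0 // ler1n.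
  by rewrite ler_ln ?posrE ?ltr0n // ler_nat.
have effT : 2399 / 400 <= eff T ^+ 2.
  by apply: le_trans (eff_T2112_sqr_ge _); lra.
have lt5 := ln5_lt _ _ (sqrtr_ge0 _) effT; rewrite -/(eff T) in lt5.
have ln5_gt0 : 0 < ln 5 :> R by rewrite ln_gt0 // ltr1n.
have lnT : 0 < ln (eff T) by lra.
exists T; split=> //; rewrite ltr_pdivrMr //; exact: le_lt_trans ln_rankT lt5.
Qed.
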